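(* Let $C$ be a finite non-empty set of points, let $T_C$ be a hierarchical grouping tree of $C$ (rooted at $C$), and let $f(\cdot;\theta)$ be an objectness function assigning to each segment a value in $[0,1]$. Then the procedure OptMinSeg$(C,T_C)$ (defined in the context) returns, as its segmentation output, an optimal worst-case segmentation of $C$ among all tree-consistent segmentations, i.e. a segmentation $P_{C,\min}^*\in S_{C,T}$ with $$P_{C,\min}^* \in \operatorname*{argmax}_{P_C\in S_{C,T}} F_{\min}(P_C;\theta).$$
   Context: **Segmentations.** A (global) segmentation of a finite set of points $X$ is a partition $P_X=\{C_1,\dots,C_M\}$ of $X$ into non-empty, pairwise disjoint subsets whose union is $X$; each $C_i\subset X$ is called a (local) segment. **Hierarchical grouping tree.** A hierarchical grouping tree $T_X$ of $X$ is a finite rooted tree in which every node is associated with a non-empty subset of $X$. The root is associated with $X$, and for every non-leaf node the sets associated with its children form a partition of the set associated with that node. Leaves need not be single points. A node is referred to by the set of points it is associated with. For a node $C$, $T_C$ denotes the subtree rooted at $C$; it is a hierarchical grouping tree of $C$. **Tree-consistent segmentations.** A vertex cut of $T_X$ is a set of nodes of $T_X$ such that (1) no node in the cut has a proper ancestor that is also in the cut, and (2) every leaf of $T_X$ is itself in the cut or has an ancestor in the cut. The collection of the point sets associated with the nodes of a vertex cut is a segmentation of $X$. The set of all segmentations of $X$ obtained in this way is denoted $S_{X,T}$, and its elements are called tree-consistent segmentations. For a node $C$, $S_{C,T}$ denotes the set of tree-consistent segmentations of $C$ with respect to the subtree $T_C$. **Scores.** The objectness function $f(\cdot;\theta)$,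 with fixed parameters $\theta$, assigns to each segment $C$ a number $f(C;\theta)\in[0,1]$. It is otherwise arbitrary; in particular, the value on a segment does not depend on how the other points are partitioned. The worst-case score of a segmentation $P_X=\{C_1,\dots,C_M\}$ is $$F_{\min}(P_X;\theta)=\min_{1\le i\le M} f(C_i;\theta).$$ **Procedure OptMinSeg$(C,T_C)$.** It returns a pair $(P_C,F_C)$ consisting of a segmentation $P_C$ of $C$ and a score $F_C$, as follows: 1. Set $P_C\leftarrow\{C\}$ and $F_C\leftarrow f(C;\theta)$. 2. Let $N_C$ be the set of children of $C$ in $T_C$. 3. If $N_C\neq\emptyset$: - (a) For each child $C_i\in N_C$ (in any order): let $T_{C_i}$ be the subtree of $T_C$ rooted at $C_i$, and compute recursively $(P_{C_i},F_{C_i})=$ OptMinSeg$(C_i,T_{C_i})$. If $F_{C_i}\le F_C$, immediately stop and return $(P_C,F_C)$. - (b) After the loop over all children, if $\min_i F_{C_i}>F_C$, set $P_C\leftarrow\bigcup_i P_{C_i}$ and $F_C\leftarrow\min_i F_{C_i}$. 4. Return $(P_C,F_C)$. *)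

(* Defs.v *)
From HB Require Import structures.
From mathcomp Require Import all_boot all_order all_algebra.

Set Implicit Arguments.
Unset Strict Implicit.
Unset Printing Implicit Defensive.

Import Order.TTheory GRing.Theory Num.Theory.
Local Open Scope ring_scope.

(* Finite rooted trees whose nodes carry a set of points.  The order of the   *)
(* list of children has no meaning for the tree itself: it only records the   *)
(* order in which the procedure [opt_min_seg] visits the children, so that    *)
(* quantifying over all trees also quantifies over all visiting orders.       *)
Inductive gtree (T : finType) : Type :=
  GNode of {set T} & seq (gtree T).

Definition points (T : finType) (t : gtree T) : {set T} :=
  let: GNode A _ := t in A.

Definition children (T : finType) (t : gtree T) : seq (gtree T) :=
  let: GNode _ ts := t in ts.

(* [uniq] is needed because [set:: _] forgets repetitions: two children with  *)
(* the same (non-empty) set of points are not disjoint.  A single child       *)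
(* carrying the same set as its parent is allowed.                            *)
Fixpoint grouping_tree (T : finType) (t : gtree T) : bool :=
  let: GNode A ts := t in
  [&& A != set0,
      nilp ts || (uniq (map (@points T) ts) &&
                  partition [set:: map (@points T) ts] A)
    & all (@grouping_tree T) ts].

Definition grouping_tree_of (T : finType) (X : {set T}) (t : gtree T) : Prop :=
  points t = X /\ grouping_tree t.

(* Nodes are identified by their address, i.e. the list of child indices read *)
(* from the root, and not by their set of points, since distinct nodes may    *)
(* carry the same set.  [subtree t a] is [None] if [a] is not a node of [t].  *)
Fixpoint subtree (T : finType) (t : gtree T) (a : seq nat) : option (gtree T) :=
  if a is i :: a' then obind (fun t' => subtree t' a') (onth (children t) i)
  else Some t.

Definition is_node (T : finType) (t : gtree T) (a : seq nat) : bool :=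
  isSome (subtree t a).

Definition is_leaf (T : finType) (t : gtree T) (a : seq nat) : bool :=
  if subtree t a is Some t' then nilp (children t') else false.

Definition node_points (T : finType) (t : gtree T) (a : seq nat) :
    option {set T} :=
  omap (@points T) (subtree t a).

Definition proper_ancestor (a b : seq nat) : bool := prefix a b && (a != b).

Definition vertex_cut (T : finType) (t : gtree T) (K : seq (seq nat)) : Prop :=
  [/\ forall a, a \in K -> is_node t a,
      forall a b, a \in K -> b \in K -> ~~ proper_ancestor b a
    & forall l, is_leaf t l ->
        l \in K \/ exists2 a, a \in K & proper_ancestor a l].

Definition cut_sets (T : finType) (t : gtree T) (K : seq (seq nat)) :
    {set {set T}} :=
  [set:: pmap (node_points t) K].

Definition segmentation (T : finType) (X : {set T}) (P : {set {set T}}) : Prop :=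
  partition P X.

Definition tree_consistent (T : finType) (t : gtree T) (P : {set {set T}}) :
    Prop :=
  segmentation (points t) P /\
  exists2 K : seq (seq nat), vertex_cut t K & P = cut_sets t K.

(* The default value 1 is neutral since scores lie in [0, 1].                 *)
Definition Fmin (R : realFieldType) (T : finType) (f : {set T} -> R)
    (P : {set {set T}}) : R :=
  \big[Num.min/1]_(A in P) f A.

(* [loop] collects the results of the recursive calls on the children, and is *)
(* [None] when a child with score at most [f A] causes an early return.       *)
Fixpoint opt_min_seg (R : realFieldType) (T : finType) (f : {set T} -> R)
    (t : gtree T) : {set {set T}} * R :=
  let: GNode A ts := t in
  let fix loop (us : seq (gtree T)) : option (seq ({set {set T}} * R)) :=
    if us is u :: us' then
      let r := opt_min_seg f u in
      if r.2 <= f A then None else omap (cons r) (loop us')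
    else Some [::] in
  match loop ts with
  | None | Some [::] => ([set A], f A)
  | Some (r :: rs) =>
      let m := \big[Num.min/r.2]_(s <- rs) s.2 in
      if f A < m then (\bigcup_(s <- r :: rs) s.1, m) else ([set A], f A)
  end.

Definition argmax (R : realFieldType) (I : Type) (S : I -> Prop) (F : I -> R)
    (x : I) : Prop :=
  S x /\ forall y, S y -> F y <= F x.

(* Main.v *)
Require Import Defs.
From mathcomp Require Import all_boot all_order all_algebra.

Set Implicit Arguments.
Unset Strict Implicit.
Unset Printing Implicit Defensive.

Import Order.TTheory GRing.Theory Num.Theory.
Local Open Scope ring_scope.

(* Write (P, F) for the output of the procedure at a node.  By induction on   *)
(* the tree, every vertex cut contains a node of score at most F: a cut that  *)
(* avoids the root restricts to a vertex cut below each child, in particular  *)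
(* below the child that caused an early return or that attained the minimum.  *)
(* Conversely, P is a tree-consistent segmentation all of whose members score *)
(* at least F.                                                                *)

(** The returned score F separates the two segmentations being compared. For a competitor coming
    from a cut, [vertex_cut_le_opt_min_seg] gives a segment of score at most F, so its [Fmin] is at
    most F; by [opt_min_seg_le_score], F is at most the [Fmin] of the output. Stopping early is
    harmless: a child scoring at most [f A] already forces every cut that avoids the root to contain
    a segment scoring at most [f A]. The output is admissible by [opt_min_seg_partition] and
    [opt_min_seg_vertex_cut]. *)

Lemma gtree_onth_ind (T : finType) (P : gtree T -> Prop) :
  (forall A ts, (forall i u, onth ts i = Some u -> P u) -> P (GNode A ts)) ->
  forall t, P t.
Proof.
move=> IH; fix loop 1 => -[A ts]; apply: IH.
(* [loop] may only be applied to the head [v], a structural subterm; it is cleared elsewhere so that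
   no closing tactic makes an unguarded call. *)
elim: ts => [|v ts IHts]; first by clear loop; case.
have Pv := loop v; clear loop.
by case=> [|i] u /= => [[<-]|/IHts].
Qed.

(** * Sequences read by index, attained minima, and refinement of partitions *)

Lemma all_onth (U : Type) (p : pred U) (s : seq U) i x :
  all p s -> onth s i = Some x -> p x.
Proof.
by elim: s i => [|y s IHs] [|i] //= /andP[py ps] => [[<-]|/IHs]; last exact.
Qed.

Lemma mem_bigcup_onth (U : Type) (T : finType) (F : U -> {set T}) s (x : T) :
  reflect (exists i u, onth s i = Some u /\ x \in F u)
          (x \in \bigcup_(u <- s) F u).
Proof.
elim: s => [|u s IHs].
  by rewrite big_nil inE; constructor; case=> -[|i] [] ? [].
rewrite big_cons inE; apply: (iffP orP).
  case=> [xu|/IHs[i [v [iv xv]]]]; first by exists 0, u.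
  by exists i.+1, v.
case=> -[|i] [v [/= iv xv]]; first by case: iv => ->; left.
by right; apply/IHs; exists i, v.
Qed.

(** The minimum starts from the first entry, as in [opt_min_seg], and not from a default, which is
    why some entry attains it. *)
Lemma bigmin_cons_attained (R : realFieldType) (U : Type) (g : U -> R) x s
    (m := \big[Num.min/g x]_(y <- s) g y) :
  (forall i y, onth (x :: s) i = Some y -> m <= g y) /\
  exists i y, onth (x :: s) i = Some y /\ m = g y.
Proof.
rewrite {}/m; elim: s => [|y s [IHle [i [z [iz eqz]]]]].
  by rewrite big_nil; split=> [i y /onth1P[_ ->] //|]; exists 0, x.
rewrite big_cons; split=> [[|[|j]] z' /=|].
- by case=> <-; rewrite ge_min (IHle 0 x) ?orbT.
- by case=> <-; rewrite ge_min lexx.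
- by move=> jz; rewrite ge_min (IHle j.+1 z') ?orbT.
case: leP => _; first by exists 1, y.
by case: i iz => [|i] iz; [exists 0, z | exists i.+2, z].
Qed.

Lemma partitionU (T : finType) (P Q : {set {set T}}) (A B : {set T}) :
  [disjoint A & B] -> partition P A -> partition Q B ->
  partition (P :|: Q) (A :|: B).
Proof.
move=> dAB PA QB; apply/and3P; split.
- rewrite /cover bigcup_setU -!/(cover _).
  by rewrite (cover_partition PA) (cover_partition QB).
- apply: trivIsetU; [exact: partition_trivIset PA|exact: partition_trivIset QB|].
  by rewrite (cover_partition PA) (cover_partition QB).
- by rewrite inE (partition0 PA) (partition0 QB).
Qed.

Lemma partition_bigcup_seq (U : Type) (T : finType) (X : U -> {set T})
    (Q : U -> {set {set T}}) (s : seq U) (A : {set T}) :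
  uniq (map X s) -> partition [set:: map X s] A ->
  (forall i u, onth s i = Some u -> partition (Q u) (X u)) ->
  partition (\bigcup_(u <- s) Q u) A.
Proof.
(* [A] becomes the union of its blocks, so that it shrinks along with [s] in the induction. *)
move=> us XA; rewrite -(cover_partition XA) /cover.
have := partition_trivIset XA; elim: s us {XA} => [|u s IHs] /=.
  by rewrite set_nil !big_nil big_set0 partition_set0 eqxx.
move=> /andP[us uniqs] tr IHQ; rewrite big_cons set_cons big_setU1 ?inE //=.
apply: partitionU; last 2 first.
- exact: IHQ 0 u erefl.
- apply: IHs => // [|i v iv]; last exact: IHQ i.+1 v iv.
  by apply: trivIsetS tr; rewrite set_cons subsetUr.
(* [uniq] makes the block [X u] differ from each later block [B]; only then does [trivIset] give
   disjointness. *)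
apply/bigcup_disjointP => B; rewrite inE => Bs.
move/trivIsetP: tr; apply; rewrite ?inE ?eqxx ?Bs ?orbT //.
by apply: contraNneq us => ->.
Qed.

(** * Restricting vertex cuts to children and grafting them back *)

Section Cuts.

Variable T : finType.
Implicit Types (A B : {set T}) (t u : gtree T) (ts : seq (gtree T)).

Lemma mem_cut_sets t K B :
  reflect (exists2 a, a \in K & node_points t a = Some B) (B \in cut_sets t K).
Proof.
rewrite inE mem_pmap; apply: (iffP mapP) => -[a aK]; first by exists a.
by move=> aB; exists a.
Qed.

Lemma grouping_tree_child A ts i u :
  grouping_tree (GNode A ts) -> onth ts i = Some u ->
  [/\ grouping_tree u, points u != set0 & points u \subset A].
Proof.
move=> /= /and3P[_ part gts] iu; have gu := all_onth gts iu; split=> //.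
  by case: (u) gu => B us /= /andP[].
case/orP: part => [/nilP ts0|/andP[_ part]]; first by rewrite ts0 onth0n in iu.
apply: partitionS part _; rewrite inE; apply/onthP; exists i.
by rewrite onth_map iu.
Qed.

Lemma node_points_cons A ts i a :
  node_points (GNode A ts) (i :: a) =
  obind (fun u => node_points u a) (onth ts i).
Proof. by rewrite /node_points /=; case: onth. Qed.

Lemma vertex_cut_root t : vertex_cut t [:: [::]].
Proof.
split=> [a|a b|l _]; rewrite ?inE; first by move/eqP->.
- by move=> /eqP-> /eqP->.
- by case: l => [|i l]; [left|right; exists [::]; rewrite ?inE].
Qed.

Lemma cut_sets_root t : cut_sets t [:: [::]] = [set points t].
Proof. by apply/setP=> B; rewrite !inE. Qed.

Definition cut_below (K : seq (seq nat)) i :=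
  [seq behead a | a <- K & ohead a == Some i].

Lemma mem_cut_below K i a : (a \in cut_below K i) = (i :: a \in K).
Proof.
apply/mapP/idP => [[[|j b]]|aK]; rewrite ?mem_filter //=.
  by case/andP=> /eqP[->] bK ->.
by exists (i :: a); rewrite // mem_filter /= eqxx.
Qed.

Lemma proper_ancestor_cons i j a b :
  proper_ancestor (i :: a) (j :: b) = (i == j) && proper_ancestor a b.
Proof. by rewrite /proper_ancestor /= eqseq_cons; case: eqP. Qed.

(** A leaf below child [i] is a leaf of the whole tree; as the root is not in [K], whatever covers
    it has an address starting with [i], hence survives in [cut_below]. *)
Lemma vertex_cut_below A ts K i u :
  vertex_cut (GNode A ts) K -> [::] \notin K -> onth ts i = Some u ->
  vertex_cut u (cut_below K i).
Proof.
move=> [nodeK antiK coverK] K0 iu; split=> [a|a b|l lu].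
- by rewrite mem_cut_below => /nodeK; rewrite /is_node /= iu.
- rewrite !mem_cut_below => aK bK.
  by have := antiK _ _ aK bK; rewrite proper_ancestor_cons eqxx.
have /coverK: is_leaf (GNode A ts) (i :: l) by rewrite /is_leaf /= iu.
rewrite -mem_cut_below; case=> [|[[|j a] aK]]; [by left|by rewrite aK in K0|].
rewrite proper_ancestor_cons => /andP[/eqP ji al]; right; exists a => //.
by rewrite mem_cut_below -ji.
Qed.

Lemma cut_sets_below A ts K i u :
  onth ts i = Some u ->
  cut_sets u (cut_below K i) \subset cut_sets (GNode A ts) K.
Proof.
move=> iu; apply/subsetP => B /mem_cut_sets[a].
rewrite mem_cut_below => aK aB; apply/mem_cut_sets; exists (i :: a) => //.
by rewrite node_points_cons iu.
Qed.

Lemma root_cut_sets A ts K : [::] \in K -> A \in cut_sets (GNode A ts) K.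
Proof. by move=> K0; apply/mem_cut_sets; exists [::]. Qed.

Lemma vertex_cut_leaf A K : vertex_cut (GNode A [::]) K -> [::] \in K.
Proof.
by case=> _ _ /(_ [::] isT)[//|[[|i a] _]]; rewrite /proper_ancestor.
Qed.

(** Addresses with different first indices are incomparable, so each cut condition reduces to a
    single child. Without children the root would be a leaf left uncovered. *)
Lemma vertex_cut_graft A ts (Q : gtree T -> {set {set T}}) :
  ts <> [::] ->
  (forall i u, onth ts i = Some u ->
     exists2 K, vertex_cut u K & Q u = cut_sets u K) ->
  exists2 K, vertex_cut (GNode A ts) K &
             \bigcup_(u <- ts) Q u = cut_sets (GNode A ts) K.
Proof.
move=> ts_n0 cutQ.
(* One cut is chosen per child index, by finite choice over ordinals. *)
have /fin_all_exists[F cutF] (i : 'I_(size ts)) : exists K, forall u,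
    onth ts i = Some u -> vertex_cut u K /\ Q u = cut_sets u K.
  case iu: (onth ts i) => [u|]; last by exists [::].
  by have [K cutK QK] := cutQ _ _ iu; exists K => _ [<-].
pose K : seq (seq nat) :=
  [seq val i :: a | i <- enum 'I_(size ts), a <- F i].
have KP a : reflect (exists (i : 'I_(size ts)) u a',
    [/\ a = val i :: a', onth ts i = Some u & a' \in F i]) (a \in K).
  apply: (iffP allpairsPdep) => [[i [a' [_ a'F ->]]]|[i [u [a' [-> _ a'F]]]]].
    have := ltn_ord i; rewrite -onthTE; case iu: onth => [u|//] _.
    by exists i, u, a'.
  by exists i, a'; rewrite mem_enum.
exists K; [split|].
- move=> a /KP[i [u [a' [-> iu a'F]]]]; have [[nodeF _ _] _] := cutF i u iu.
  by rewrite /is_node /= iu; apply: nodeF.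
- move=> a b /KP[i [u [a' [-> iu a'F]]]] /KP[j [v [b' [-> jv b'F]]]].
  rewrite proper_ancestor_cons; apply/negP => /andP[/eqP/ord_inj ji].
  rewrite {j}ji in jv b'F *; have [[_ antiF _] _] := cutF i u iu.
  exact/negP/antiF.
- move=> [|i l]; first by move/nilP.
  rewrite /is_leaf /=; case iu: onth => [u|//] /= leafl.
  have ltis : (i < size ts)%N by rewrite -onthTE iu.
  have [[_ _ /(_ l leafl) coverF] _] := cutF (Ordinal ltis) u iu.
  case: coverF => [lF|[a aF al]].
    by left; apply/KP; exists (Ordinal ltis), u, l.
  right; exists (i :: a); last by rewrite proper_ancestor_cons eqxx.
  by apply/KP; exists (Ordinal ltis), u, a.
apply/setP => B; apply/mem_bigcup_onth/mem_cut_sets.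
  case=> i [u [iu BQ]].
  have ltis : (i < size ts)%N by rewrite -onthTE iu.
  have [_ QF] := cutF (Ordinal ltis) u iu.
  move: BQ; rewrite QF => /mem_cut_sets[a aF aB].
  exists (i :: a); last by rewrite node_points_cons iu.
  by apply/KP; exists (Ordinal ltis), u, a.
case=> _ /KP[i [u [a [-> iu aF]]]]; rewrite node_points_cons iu /= => aB.
exists i, u; split=> //; have [_ ->] := cutF i u iu.
by apply/mem_cut_sets; exists a.
Qed.

End Cuts.

(** * Analysis of the procedure *)

Section OptMinSeg.

Variables (R : realFieldType) (T : finType) (f : {set T} -> R).
Implicit Types (A B : {set T}) (t u : gtree T) (ts : seq (gtree T)).

Lemma opt_min_segE A ts :
  opt_min_seg f (GNode A ts) =
  if has (fun u => (opt_min_seg f u).2 <= f A) ts then ([set A], f A) else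
  if map (opt_min_seg f) ts is r :: rs then
    let m := \big[Num.min/r.2]_(s <- rs) s.2 in
    if f A < m then (\bigcup_(s <- r :: rs) s.1, m) else ([set A], f A)
  else ([set A], f A).
Proof.
rewrite /=.
(* The anonymous inner fixpoint is named, so that induction on [ts] can characterize it. *)
match goal with |- context [match ?l ts with Some _ => _ | None => _ end] =>
  set loop := l
end.
have -> : loop ts = if has (fun u => (opt_min_seg f u).2 <= f A) ts then None
                    else Some (map (opt_min_seg f) ts).
  by elim: ts => //= u us ->; case: ifP => //=; case: has.
by case: has => //; case: ts.
Qed.

(** Each outcome comes with its witness: a leaf or a child scoring at most [f A] for keeping [A], a
    child of minimal score for splitting. *)
Variant opt_min_seg_spec A ts : {set {set T}} * R -> Prop :=
| OptKeep of ts = [::] \/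
    (exists i u, onth ts i = Some u /\ (opt_min_seg f u).2 <= f A) :
    opt_min_seg_spec A ts ([set A], f A)
| OptSplit i u of onth ts i = Some u & f A < (opt_min_seg f u).2
    & (forall j v, onth ts j = Some v ->
         (opt_min_seg f u).2 <= (opt_min_seg f v).2) :
    opt_min_seg_spec A ts
      (\bigcup_(v <- ts) (opt_min_seg f v).1, (opt_min_seg f u).2).

Lemma opt_min_segP A ts : opt_min_seg_spec A ts (opt_min_seg f (GNode A ts)).
Proof.
rewrite opt_min_segE; case: ifP => [hasA|_].
  constructor; right; elim: ts hasA => //= u ts IHts /orP[leA|/IHts[i [v ?]]].
    by exists 0, u.
  by exists i.+1, v.
case: ts => [|u ts] /=; first by constructor; left.
rewrite -map_cons !big_map.
have [le_m [i [v [iv eq_m]]]] :=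
  bigmin_cons_attained (snd \o opt_min_seg f) u ts.
rewrite /= in eq_m le_m; rewrite eq_m in le_m *; case: ltP => [ltA|leA].
  exact: (OptSplit iv ltA le_m).
by constructor; right; exists i, v.
Qed.

Lemma opt_min_seg_partition t :
  grouping_tree t -> partition (opt_min_seg f t).1 (points t).
Proof.
elim/gtree_onth_ind: t => A ts IH gt.
case: opt_min_segP => [_|i u iu _ _] /=.
  have /and3P[A0 _ _] := gt; apply/and3P; split.
  - by rewrite /cover big_set1.
  - exact: trivIset1.
  - by rewrite inE eq_sym.
have /= /and3P[_ /orP[/nilP ts0|/andP[uts pts]] _] := gt.
  by rewrite ts0 onth0n in iu.
apply: partition_bigcup_seq uts pts _ => j v jv; apply: (IH j v jv).
by have [] := grouping_tree_child gt jv.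
Qed.

Lemma opt_min_seg_vertex_cut t :
  exists2 K, vertex_cut t K & (opt_min_seg f t).1 = cut_sets t K.
Proof.
elim/gtree_onth_ind: t => A ts IH; case: opt_min_segP => [_|i u iu _ _] /=.
  by exists [:: [::]]; [exact: vertex_cut_root|rewrite cut_sets_root].
by apply: vertex_cut_graft IH => ts0; rewrite ts0 onth0n in iu.
Qed.

Lemma opt_min_seg_le_score t B :
  B \in (opt_min_seg f t).1 -> (opt_min_seg f t).2 <= f B.
Proof.
elim/gtree_onth_ind: t => A ts IH; case: opt_min_segP => [_|i u _ _ le_u] /=.
  by rewrite inE => /eqP->.
by case/mem_bigcup_onth=> j [v [jv /(IH _ _ jv)]]; apply: le_trans (le_u _ _ jv).
Qed.

(** This lets the bounds on [f] apply to the returned score. *)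
Lemma opt_min_seg_score_node t :
  grouping_tree t ->
  exists B, [/\ B != set0, B \subset points t & (opt_min_seg f t).2 = f B].
Proof.
elim/gtree_onth_ind: t => A ts IH gt; case: opt_min_segP => [_|i u iu _ _] /=.
  by have /and3P[A0 _ _] := gt; exists A.
have [gu _ uA] := grouping_tree_child gt iu.
have [B [B0 Bu ->]] := IH i u iu gu.
by exists B; split=> //; apply: subset_trans uA.
Qed.

Lemma vertex_cut_le_opt_min_seg t K :
  vertex_cut t K ->
  exists2 B, B \in cut_sets t K & f B <= (opt_min_seg f t).2.
Proof.
elim/gtree_onth_ind: t K => A ts IH K cutK.
have [K0|K0] := boolP ([::] \in K).
  exists A; first exact: root_cut_sets.
  (* Whichever branch is taken, the returned score is at least [f A]. *)
  by case: opt_min_segP => //= i u _ /ltW.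
have below i u : onth ts i = Some u ->
    exists2 B, B \in cut_sets (GNode A ts) K & f B <= (opt_min_seg f u).2.
  move=> iu; have [B BK fB] := IH i u iu _ (vertex_cut_below cutK K0 iu).
  by exists B => //; apply: subsetP BK; apply: cut_sets_below.
(* The cut is examined below the child that determined the outcome; at a leaf, the only cut contains
   the root. *)
case: opt_min_segP => [[ts0|[i [u [iu leA]]]]|i u iu _ _]; last exact: below iu.
  by rewrite ts0 in cutK; rewrite (vertex_cut_leaf cutK) in K0.
by have [B BK fB] := below i u iu; exists B => //; apply: le_trans leA.
Qed.

End OptMinSeg.

Theorem theorem1 (R : realFieldType) (T : finType) (C : {set T})
    (hC : C != set0) (t : gtree T) (ht : grouping_tree_of C t)
    (f : {set T} -> R)
    (hf : forall A : {set T}, A != set0 -> A \subset C -> 0 <= f A <= 1) :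
  argmax (tree_consistent t) (Fmin f) (opt_min_seg f t).1.
Proof.
case: ht => tC gt; split.
  by split; [exact: opt_min_seg_partition|exact: opt_min_seg_vertex_cut].
move=> P [_ [K /(vertex_cut_le_opt_min_seg f)[B BK fB] ->]].
apply: (@le_trans _ _ (opt_min_seg f t).2).
  exact: le_trans (bigmin_le_cond _ _ BK) fB.
(* The remaining goal compares the score with the default 1 of [Fmin]. *)
apply: le_bigmin => [|A]; last exact: opt_min_seg_le_score.
have [A [A0 At ->]] := opt_min_seg_score_node f gt.
by rewrite tC in At; have /andP[] := hf A A0 At.
Qed.
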